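(* Let $(L,[,\ldots,],\alpha=(\alpha_1,\ldots,\alpha_{n-1}))$ be an $n$-ary Hom-Nambu-Lie algebra with $n\ge 3$. Suppose for some $k\in\{1,\ldots,n-2\}$ there exist $a_i\in L$ for $1\le i\le k$ satisfying $$\alpha_i(a_i)=a_i\quad\text{for }1\le i\le k.$$ Then $$L_k=(L,[,\ldots,]_k,(\alpha_{k+1},\ldots,\alpha_{n-1})),\qquad [x_{k+1},\ldots,x_n]_k=[a_1,\ldots,a_k,x_{k+1},\ldots,x_n]\ \ (x_l\in L),$$ is an $(n-k)$-ary Hom-Nambu-Lie algebra. Moreover, if $L$ is multiplicative, then so is $L_k$.
   Context: We work over a fixed field $\mathbf{k}$ of characteristic $0$. For an integer $n\ge 2$, an $n$-ary Hom-algebra $(V,[,\ldots,],\alpha=(\alpha_1,\ldots,\alpha_{n-1}))$ consists of a $\mathbf{k}$-module $V$, an $n$-linear map $[,\ldots,]\colon V^{\otimes n}\to V$, and linear maps $\alpha_i\colon V\to V$ ($1\le i\le n-1$), called twisting maps. It is multiplicative if $\alpha_1=\cdots=\alpha_{n-1}=\alpha$ and $\alpha\circ[,\ldots,]=[,\ldots,]\circ\alpha^{\otimes n}$. The product is anti-symmetric if $[x_1,\ldots,x_n]=\epsilon(\sigma)[x_{\sigma(1)},\ldots,x_{\sigma(n)}]$ for all $x_i\in V$ and all permutations $\sigma$ of $n$ letters, with $\epsilon(\sigma)$ the signature of $\sigma$. An $n$-ary Hom-Nambu-Lie algebra is an $n$-ary Hom-algebra whose product is anti-symmetric and which satisfies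 the $n$-ary Hom-Nambu identity $$[\alpha_1(x_1),\ldots,\alpha_{n-1}(x_{n-1}),[y_1,\ldots,y_n]]=\sum_{i=1}^n[\alpha_1(y_1),\ldots,\alpha_{i-1}(y_{i-1}),[x_1,\ldots,x_{n-1},y_i],\alpha_i(y_{i+1}),\ldots,\alpha_{n-1}(y_n)]$$ for all $x_1,\ldots,x_{n-1},y_1,\ldots,y_n\in V$. *)

(* Defs.v *)
From mathcomp Require Import all_boot all_fingroup all_algebra.

Set Implicit Arguments.
Unset Strict Implicit.
Unset Printing Implicit Defensive.

Import GRing.Theory.
Local Open Scope ring_scope.

(* Indices are shifted by one: the arguments of an n-ary product are indexed
   by 'I_n = {0, ..., n-1} and the twisting maps by 'I_n.-1. *)

Section HomAlgebras.
Variables (K : fieldType) (V : lmodType K) (n : nat).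
Implicit Types (br : {ffun 'I_n -> V} -> V) (alpha : 'I_n.-1 -> {linear V -> V}).
Implicit Types (x y : {ffun 'I_n -> V}).

Definition subst_arg x (i : 'I_n) (v : V) : {ffun 'I_n -> V} :=
  [ffun j => if j == i then v else x j].

Definition multilinear br : Prop :=
  forall x (i : 'I_n), linear (fun v => br (subst_arg x i v)).

Definition hom_algebra br alpha : Prop := (2 <= n)%N /\ multilinear br.

Definition hom_multiplicative br alpha : Prop :=
  exists alpha0 : {linear V -> V},
    (forall i, alpha i =1 alpha0) /\
    (forall x, alpha0 (br x) = br [ffun i => alpha0 (x i)]).

Definition antisymmetric_product br : Prop :=
  forall x (s : 'S_n), br x = (-1) ^+ s *: br [ffun i => x (s i)].

(* (w_1, ..., w_{n-1}, v); the partial map [insub] is undefined exactly at the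
   last index n-1. *)
Definition append_last (w : {ffun 'I_n.-1 -> V}) (v : V) : {ffun 'I_n -> V} :=
  [ffun j : 'I_n =>
     if insub (val j) is Some l then w (l : 'I_n.-1) else v].

(* (alpha_1(y_1), ..., alpha_{i-1}(y_{i-1}), v, alpha_i(y_{i+1}), ...,
   alpha_{n-1}(y_n)): [unlift i j] is [None] for j = i, and otherwise the
   index j (if j < i) or j-1 (if j > i). *)
Definition twist_around alpha y (i : 'I_n) (v : V) : {ffun 'I_n -> V} :=
  [ffun j => if unlift i j is Some l then alpha l (y j) else v].

Definition hom_nambu_identity br alpha : Prop :=
  forall (x : {ffun 'I_n.-1 -> V}) y,
    br (append_last [ffun l => alpha l (x l)] (br y)) =
    \sum_(i < n) br (twist_around alpha y i (br (append_last x (y i)))).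

Definition hom_nambu_lie br alpha : Prop :=
  [/\ hom_algebra br alpha, antisymmetric_product br
    & hom_nambu_identity br alpha].

End HomAlgebras.

Lemma leq_sub2_arity n k : (k <= n - 2)%N -> (k <= n)%N.
Proof. by move=> h; apply: leq_trans h (leq_subr 2 n). Qed.

Lemma leq_sub2_twists n k : (k <= n - 2)%N -> (k <= n.-1)%N.
Proof. by move=> h; apply: leq_trans h _; rewrite -subn1 leq_sub2l. Qed.

Lemma shift_twist_subproof n k (j : 'I_(n - k).-1) : (k + j < n.-1)%N.
Proof. by case: j => j /=; rewrite !ltn_predRL ltn_subRL addnS. Qed.

Section FixArguments.
Variables (K : fieldType) (V : lmodType K) (n k : nat).

(* (a_1, ..., a_k, x_{k+1}, ..., x_n) *)
Definition prepend_args (hk : (k <= n)%N) (a : {ffun 'I_k -> V})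
    (x : {ffun 'I_(n - k) -> V}) : {ffun 'I_n -> V} :=
  [ffun i : 'I_n => match split (cast_ord (esym (subnKC hk)) i) with
                    | inl l => a l
                    | inr r => x r
                    end].

Definition fixed_product (br : {ffun 'I_n -> V} -> V) (hk : (k <= n)%N)
    (a : {ffun 'I_k -> V}) (x : {ffun 'I_(n - k) -> V}) : V :=
  br (prepend_args hk a x).

(* (alpha_{k+1}, ..., alpha_{n-1}) *)
Definition tail_twists (alpha : 'I_n.-1 -> {linear V -> V})
    (j : 'I_(n - k).-1) : {linear V -> V} :=
  alpha (Ordinal (shift_twist_subproof j)).

End FixArguments.

Arguments tail_twists {K V n} k alpha j.

(* Main.v *)
(* Apply the Hom-Nambu identity of L to (a_1, ..., a_k, x) and
   (a_1, ..., a_k, y). On the right-hand side, each of the first k summands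
   contains an inner product [a_1, ..., a_k, x, a_i] with a repeated argument,
   which vanishes by anti-symmetry as 2 is invertible; since alpha_i fixes a_i,
   the remaining n - k summands are those of the identity for L_k. *)
Require Import Defs.
From mathcomp Require Import all_boot all_fingroup all_algebra.

Set Implicit Arguments.
Unset Strict Implicit.
Unset Printing Implicit Defensive.

Import GRing.Theory.
Local Open Scope ring_scope.

Section Products.
Variables (K : fieldType) (L : lmodType K) (n : nat).
Implicit Types (br : {ffun 'I_n -> L} -> L) (x : {ffun 'I_n -> L}).

Lemma multilinear_arg0 br x (i : 'I_n) :
  multilinear br -> x i = 0 -> br x = 0.
Proof.
(* With scalar [-1] and both vectors [0], linearity reads [f 0 = - f 0 + f 0], whose right-hand side
   is [0]. *)
move=> lin_br xi0; have brD := lin_br x i (-1) 0 0.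
have -> : x = subst_arg x i 0.
  by apply/ffunP => j; rewrite ffunE; case: eqP => // ->.
by move: brD => /=; rewrite scaler0 addr0 scaleN1r addNr.
Qed.

(** The transposition of [i] and [j] leaves [x] unchanged but flips the sign, so [2 *: br x = 0],
    and [2 != 0] in characteristic 0. *)
Lemma antisymmetric_repeated_arg br x (i j : 'I_n) :
  [pchar K] =i pred0 -> antisymmetric_product br ->
  i != j -> x i = x j -> br x = 0.
Proof.
move=> charK anti_br ij xij; have := anti_br x (tperm i j).
have -> : [ffun l => x (tperm i j l)] = x.
  by apply/ffunP => l; rewrite ffunE; case: tpermP => // ->.
rewrite odd_tperm ij expr1 scaleN1r => /eqP.
rewrite -addr_eq0 -mulr2n -scaler_nat scaler_eq0.
by have/pcharf0P-> := charK; move/eqP.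
Qed.

(** Transpositions generate the symmetric group, by induction on a factorisation. This avoids
    extending a permutation of the free arguments to all [n] positions and comparing signatures. *)
Lemma antisymmetric_tperm br :
  (forall x (i j : 'I_n), i != j -> br [ffun l => x (tperm i j l)] = - br x) ->
  antisymmetric_product br.
Proof.
move=> br_tperm x s; have [ts -> dts] := prod_tpermP s.
elim: ts dts x => [_ x|[i j] ts IHts /andP[ij dts] x].
  rewrite big_nil odd_perm1 scale1r; congr br.
  by apply/ffunP => l; rewrite ffunE perm1.
rewrite big_cons odd_mul_tperm /= in ij *; rewrite ij signrN scaleNr.
set t := (\prod_(_ <- _) _)%g in IHts *.
(* Products of permutations act left factor first, so the transposition permutes the arguments of
   the tuple already permuted by [t]. *)
have -> : [ffun l => x ((tperm i j * t)%g l)] =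
          [ffun l => [ffun l' => x (t l')] (tperm i j l)].
  by apply/ffunP => l; rewrite !ffunE permM.
by rewrite br_tperm // scalerN opprK -IHts.
Qed.

End Products.

Section Arity.
Variables (K : fieldType) (L : lmodType K) (n k : nat) (hk : (k <= n)%N).
Implicit Types (br : {ffun 'I_n -> L} -> L) (alpha : 'I_n.-1 -> {linear L -> L}).
Implicit Types (a : {ffun 'I_k -> L}) (x : {ffun 'I_(n - k) -> L}).

Definition head_ord (i : 'I_k) : 'I_n := cast_ord (subnKC hk) (lshift (n - k) i).
Definition tail_ord (j : 'I_(n - k)) : 'I_n := cast_ord (subnKC hk) (rshift k j).

(** A case-analysis view that hides the casts along [k + (n - k) = n]. *)
Variant head_tail_spec : 'I_n -> Type :=
| IsHead i : head_tail_spec (head_ord i)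
| IsTail j : head_tail_spec (tail_ord j).

Lemma head_tailP i : head_tail_spec i.
Proof.
rewrite -[i](cast_ordKV (subnKC hk)).
by case: (split_ordP (cast_ord (esym (subnKC hk)) i)) => j ->;
  [left | right].
Qed.

Lemma tail_ord_inj : injective tail_ord.
Proof. by move=> i j /cast_ord_inj/rshift_inj. Qed.

Lemma head_tail_neq i j : head_ord i != tail_ord j.
Proof. by rewrite -val_eqE /= neq_ltn ltn_addr. Qed.

Lemma prepend_head a x i : prepend_args hk a x (head_ord i) = a i.
Proof. by rewrite ffunE cast_ordK (unsplitK (inl i)). Qed.

Lemma prepend_tail a x j : prepend_args hk a x (tail_ord j) = x j.
Proof. by rewrite ffunE cast_ordK (unsplitK (inr j)). Qed.

Lemma big_head_tail (F : 'I_n -> L) :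
  \sum_i F i = \sum_i F (head_ord i) + \sum_j F (tail_ord j).
Proof.
rewrite (reindex (cast_ord (subnKC hk))) ?big_split_ord //.
by apply: onW_bij; exists (cast_ord (esym (subnKC hk)));
  [apply: cast_ordK | apply: cast_ordKV].
Qed.

Lemma subst_prepend a x j v :
  prepend_args hk a (subst_arg x j v) =
  subst_arg (prepend_args hk a x) (tail_ord j) v.
Proof.
apply/ffunP => i; rewrite [RHS]ffunE; case: (head_tailP i) => l.
  by rewrite !prepend_head (negPf (head_tail_neq _ _)).
by rewrite !prepend_tail ffunE (inj_eq tail_ord_inj).
Qed.

Lemma fixed_multilinear br a :
  multilinear br -> multilinear (fixed_product br hk a).
Proof.
move=> lin_br x j c u v; rewrite /fixed_product !subst_prepend.
exact: lin_br.
Qed.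

(** A transposition of two free arguments is a transposition of their shifted positions among all
    [n], and it leaves every [a i] in place. *)
Lemma fixed_antisymmetric br a :
  antisymmetric_product br -> antisymmetric_product (fixed_product br hk a).
Proof.
move=> anti_br; apply: antisymmetric_tperm => x i j ij.
rewrite /fixed_product [in RHS](anti_br _ (tperm (tail_ord i) (tail_ord j))).
rewrite odd_tperm (inj_eq tail_ord_inj) ij expr1 scaleN1r opprK.
congr br; apply/ffunP => l; rewrite [RHS]ffunE; case: (head_tailP l) => m.
  by rewrite tpermD ?prepend_head // eq_sym head_tail_neq.
by rewrite -(inj_tperm _ _ _ tail_ord_inj) !prepend_tail ffunE.
Qed.

(** The common twisting map is existentially bound in [hom_multiplicative], so the fixed-point
    condition is assumed for any map that all [alpha i] agree with. *)
Lemma fixed_multiplicative br alpha a :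
  (forall (alpha0 : {linear L -> L}),
     (forall i, alpha i =1 alpha0) -> forall i, alpha0 (a i) = a i) ->
  hom_multiplicative br alpha ->
  hom_multiplicative (fixed_product br hk a) (tail_twists k alpha).
Proof.
move=> fix_a [alpha0 [alphaE br_alpha]]; exists alpha0.
split=> [i|x]; first exact: alphaE.
rewrite /fixed_product br_alpha; congr br; apply/ffunP => i; rewrite ffunE.
case: (head_tailP i) => j; first by rewrite !prepend_head (fix_a _ alphaE).
by rewrite !prepend_tail ffunE.
Qed.

End Arity.

Section Identity.
Variables (K : fieldType) (L : lmodType K) (n k : nat).
Variables (hk : (k <= n)%N) (hk1 : (k <= n.-1)%N).
Implicit Types (br : {ffun 'I_n -> L} -> L) (alpha : 'I_n.-1 -> {linear L -> L}).
Implicit Types (a : {ffun 'I_k -> L}) (y : {ffun 'I_(n - k) -> L}).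

Lemma pred_subnE : (n.-1 - k = (n - k).-1)%N.
Proof. by rewrite -!subn1 subnAC. Qed.

(** The left-hand tuple for the identity of [L]; the cast is needed because [n.-1 - k] and
    [(n - k).-1] are not convertible. *)
Definition prepend_twisted a (x : {ffun 'I_(n - k).-1 -> L}) :
    {ffun 'I_n.-1 -> L} :=
  prepend_args hk1 a [ffun j => x (cast_ord pred_subnE j)].

Lemma prepend_twisted_head a x (l : 'I_n.-1) (i : 'I_k) :
  val l = val i -> prepend_twisted a x l = a i.
Proof.
by move=> li; rewrite -(prepend_head hk1 a [ffun j => x (cast_ord pred_subnE j)]);
   congr (prepend_twisted _ _ _); apply: val_inj.
Qed.

Lemma prepend_twisted_tail a x (l : 'I_n.-1) (j : 'I_(n - k).-1) :
  val l = (k + j)%N -> prepend_twisted a x l = x j.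
Proof.
move=> lj; have -> : l = tail_ord hk1 (cast_ord (esym pred_subnE) j).
  exact: val_inj.
by rewrite /prepend_twisted prepend_tail ffunE cast_ordKV.
Qed.

Lemma append_last_prepend a (x : {ffun 'I_(n - k).-1 -> L}) v :
  append_last (prepend_twisted a x) v = prepend_args hk a (append_last x v).
Proof.
apply/ffunP => i; rewrite ffunE; case: (head_tailP hk i) => j.
  rewrite prepend_head; case: insubP => [l _ lE|].
    exact: prepend_twisted_head.
  by rewrite /= (leq_trans (ltn_ord j)).
(* Both [insub] tests agree, since [k + j < n.-1] iff [j < (n - k).-1]; the mixed cases are
   contradictory. *)
rewrite prepend_tail ffunE /=; case: insubP => [l lt_l lE|ge_l].
  case: insubP => [m _ mE|]; first by apply: prepend_twisted_tail; rewrite lE mE.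
  by rewrite -pred_subnE ltn_subRL lt_l.
by case: insubP => // m lt_m; rewrite -ltn_subRL pred_subnE lt_m in ge_l.
Qed.

Lemma map_prepend_twisted alpha a (x : {ffun 'I_(n - k).-1 -> L}) :
  (forall i, alpha (widen_ord hk1 i) (a i) = a i) ->
  [ffun l => alpha l (prepend_twisted a x l)] =
  prepend_twisted a [ffun l => tail_twists k alpha l (x l)].
Proof.
move=> fix_a; apply/ffunP => l; rewrite ffunE; case: (head_tailP hk1 l) => j.
  rewrite !(@prepend_twisted_head _ _ _ j) // -[RHS]fix_a.
  by congr (alpha _ _); apply: val_inj.
rewrite !(@prepend_twisted_tail _ _ _ (cast_ord pred_subnE j)) // ffunE.
by congr (alpha _ _); apply: val_inj.
Qed.

(** The head lies before the omitted position, so each [a l] meets the twisting map of its own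
    index, which fixes it; on the tail, omitting a position commutes with the shift by [k]. *)
Lemma twist_around_prepend alpha a y (i : 'I_(n - k)) v :
  (forall i, alpha (widen_ord hk1 i) (a i) = a i) ->
  twist_around alpha (prepend_args hk a y) (tail_ord hk i) v =
  prepend_args hk a (twist_around (tail_twists k alpha) y i v).
Proof.
move=> fix_a; apply/ffunP => j; rewrite ffunE; case: (head_tailP hk j) => l.
  rewrite !prepend_head; case: unliftP => [m mE|/eqP]; last first.
    by rewrite (negPf (head_tail_neq _ _ _)).
  rewrite -[RHS]fix_a; congr (alpha _ _); apply: val_inj => /=.
  move/(congr1 val): mE; rewrite /= /bump => lE; have := ltn_ord l.
  (* If [k + i <= m], then [l = m.+1 > k], contradicting [l < k]; otherwise [m = l]. *)
  case: (leqP (k + i) m) lE => [le_im -> | //].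
  by rewrite ltnNge (leq_trans (leq_addr i k)) // leqW.
rewrite !prepend_tail ffunE; case: (unliftP i l) => [m ->|->]; last first.
  by rewrite unlift_none.
have -> : tail_ord hk (lift i m) =
          lift (tail_ord hk i) (Ordinal (shift_twist_subproof m)).
  by apply: val_inj; rewrite /= /bump leq_add2l addnCA.
by rewrite liftK.
Qed.

Lemma fixed_hom_nambu br alpha a :
  [pchar K] =i pred0 -> multilinear br -> antisymmetric_product br ->
  (forall i, alpha (widen_ord hk1 i) (a i) = a i) ->
  hom_nambu_identity br alpha ->
  hom_nambu_identity (fixed_product br hk a) (tail_twists k alpha).
Proof.
move=> charK lin_br anti_br fix_a nambu x y.
rewrite /fixed_product -!append_last_prepend -map_prepend_twisted // nambu.
rewrite (big_head_tail hk) big1 ?add0r => [|i _].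
  apply: eq_bigr => i _; rewrite twist_around_prepend //.
  by rewrite prepend_tail append_last_prepend.
apply: (multilinear_arg0 (i := head_ord hk i)) => //.
rewrite ffunE unlift_none prepend_head append_last_prepend.
(* A last free position exists: the index [i] shows [0 < n], whence [k <= n.-1 < n]. The inner
   product carries [a i] both there and at head position [i]. *)
have lt_last : ((n - k).-1 < n - k)%N.
  rewrite ltn_predL subn_gt0 (leq_ltn_trans hk1) // ltn_predL.
  exact: leq_ltn_trans (ltn_ord (head_ord hk i)).
apply: (antisymmetric_repeated_arg (i := head_ord hk i)
  (j := tail_ord hk (Ordinal lt_last))) => //; first exact: head_tail_neq.
rewrite prepend_head prepend_tail ffunE /=.
by case: insubP => //= m; rewrite ltnn.
Qed.

End Identity.

Theorem corollary6p5 (K : fieldType) (charK : [pchar K] =i pred0)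
    (n : nat) (hn : (3 <= n)%N)
    (L : lmodType K) (br : {ffun 'I_n -> L} -> L)
    (alpha : 'I_n.-1 -> {linear L -> L}) (hL : hom_nambu_lie br alpha)
    (k : nat) (hk1 : (1 <= k)%N) (hk2 : (k <= n - 2)%N)
    (a : {ffun 'I_k -> L})
    (ha : forall i : 'I_k,
        alpha (widen_ord (leq_sub2_twists hk2) i) (a i) = a i) :
  hom_nambu_lie (fixed_product br (leq_sub2_arity hk2) a)
                (tail_twists k alpha) /\
  (hom_multiplicative br alpha ->
   hom_multiplicative (fixed_product br (leq_sub2_arity hk2) a)
                  (tail_twists k alpha)).
Proof.
have [[n2 lin_br] anti_br nambu] := hL; split.
  split; first split.
  - by rewrite leq_subCr // (leq_sub2_arity hk2).
  - exact: fixed_multilinear.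
  - exact: fixed_antisymmetric.
  - exact: fixed_hom_nambu ha nambu.
by apply: fixed_multiplicative => alpha0 alphaE i; rewrite -[RHS]ha alphaE.
Qed.
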